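(* Let $G$ be a group and let $N$ and $H$ be normal subgroups of $G$ with $N\subseteq H$. Then $$\underline{\operatorname{Apr}}_{G/N}(H/N)=H/N=\overline{\operatorname{Apr}}_{G/N}(H/N).$$
   Context: Let $G$ be a group (written multiplicatively) and $N$ a normal subgroup of $G$. The relation $\theta$ on $G/N$ is conjugacy: $xN\,\theta\, yN$ iff $xN=(aya^{-1})N$ for some $a\in G$; the class of $xN$ is $[xN]_\theta=\{(axa^{-1})N : a\in G\}$. For a subset $S\subseteq G/N$, the lower and upper approximations are $\underline{\operatorname{Apr}}_{G/N}(S)=\{xN\in G/N : [xN]_\theta\subseteq S\}$ and $\overline{\operatorname{Apr}}_{G/N}(S)=\{xN\in G/N : [xN]_\theta\cap S\neq\varnothing\}$. Here $H/N=\{hN : h\in H\}\subseteq G/N$. *)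

(* Defs.v *)
From mathcomp Require Import all_boot.
From mathcomp Require Import boolp classical_sets.

Set Implicit Arguments.
Unset Strict Implicit.
Unset Printing Implicit Defensive.

Local Open Scope group_scope.
Local Open Scope classical_set_scope.

(* [groupType] is not restricted to finite groups.  A coset xN is a [set G],
   so that G/N and its subsets are of type [set (set G)]. *)

Definition normal_subgroup (G : groupType) (N : set G) : Prop :=
  group_closed (mem N) /\ forall g n : G, N n -> N (g * n * g^-1).

Definition lcoset (G : groupType) (N : set G) (x : G) : set G :=
  [set x * n | n in N].

(* A/N = {aN : a in A}; the whole of G/N is [quotient N setT]. *)
Definition quotient (G : groupType) (N A : set G) : set (set G) :=
  [set lcoset N x | x in A].

(* The representative y of D is existentially quantified; when N is normal the
   choice is irrelevant, see [conj_class_lcoset]. *)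
Definition conj_rel (G : groupType) (N : set G) (C D : set G) : Prop :=
  exists y a : G, D = lcoset N y /\ C = lcoset N (a * y * a^-1).

Definition conj_class (G : groupType) (N : set G) (C : set G) : set (set G) :=
  [set D | conj_rel N D C].

Definition lower_apr (G : groupType) (N : set G) (S : set (set G)) :
    set (set G) :=
  [set C | quotient N setT C /\ conj_class N C `<=` S].

Definition upper_apr (G : groupType) (N : set G) (S : set (set G)) :
    set (set G) :=
  [set C | quotient N setT C /\ conj_class N C `&` S !=set0].

Lemma conj_class_lcoset (G : groupType) (N : set G) (x : G) :
  normal_subgroup N ->
  conj_class N (lcoset N x) = [set lcoset N (a * x * a^-1) | a in setT].
Proof.
move=> [Ngrp Nnorm]; have [N1 ND] := Ngrp.
have NM u v : N u -> N v -> N (u * v).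
  move=> Nu Nv; apply: set_mem; apply: (group_closedM Ngrp); exact: mem_set.
have NV u : N u -> N u^-1.
  by move=> Nu; apply: set_mem; apply: (group_closedV Ngrp); exact: mem_set.
have {}N1 : N 1 := set_mem N1.
have lcosetM y n : N n -> lcoset N (y * n) = lcoset N y.
  move=> Nn; apply/seteqP; split=> _ [m Nm <-].
    by exists (n * m); [exact: NM | rewrite mulgA].
  by exists (n^-1 * m); [exact: NM (NV _ Nn) Nm | rewrite mulgA mulgK].
apply/seteqP; split=> C /=; last by move=> [a _ <-]; exists x, a.
move=> [y [a [xNy ->]]]; exists a => //.
have [n Nn <-] : lcoset N x y by rewrite xNy; exists 1; rewrite ?mulg1.
have -> : a * (x * n) * a^-1 = a * x * a^-1 * (a * n * a^-1).
  by rewrite !mulgA mulgVK.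
by rewrite (lcosetM _ _ (Nnorm a n Nn)).
Qed.

(* Main.v *)
Require Import Defs.
From mathcomp Require Import all_boot.
From mathcomp Require Import boolp classical_sets.

Local Open Scope classical_set_scope.

(** The subset [H/N] of [G/N] is a union of conjugacy classes
    ([quotient_conj_class]): as [N] lies in [H], a coset [xN] belongs to [H/N]
    exactly when [x] is in [H] ([quotient_lcoset]), and [H] is stable under
    conjugation.  Since each coset lies in its own class
    ([conj_class_refl]), a class meets [H/N] if and only if its coset is in
    [H/N], if and only if the whole class is contained in [H/N]; this is the
    equality of both approximations with [H/N]. *)

Section NormalSubgroup.

Local Open Scope group_scope.

Variable G : groupType.
Implicit Types (N H : set G) (x y : G) (C D : set G).

Lemma normal_subgroup1 N : normal_subgroup N -> N 1.
Proof. by move=> [[N1 _] _]; exact: set_mem N1. Qed.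

Lemma normal_subgroupM N x y : normal_subgroup N -> N x -> N y -> N (x * y).
Proof.
by move=> [Ngrp _] Nx Ny; apply: set_mem; apply: (group_closedM Ngrp);
  exact: mem_set.
Qed.

Lemma normal_subgroupJ N x y :
  normal_subgroup N -> N (x * y * x^-1) <-> N y.
Proof.
move=> [_ Nnorm]; split=> [/(Nnorm x^-1)|]; last exact: Nnorm.
by rewrite invgK !mulgA mulVg mul1g mulgVK.
Qed.

(** A coset [xN] in [H/N] is [hN] for some [h] in [H] that may differ from
    [x]; but then [x] is in [hN], which lies in [H] because [N] does. *)
Lemma quotient_lcoset N H x :
    normal_subgroup N -> normal_subgroup H -> N `<=` H ->
  quotient N H (lcoset N x) <-> H x.
Proof.
move=> nN nH NH; split=> [[h Hh hNxN]|Hx]; last by exists x.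
have [n Nn <-] : lcoset N h x.
  by rewrite hNxN; exists 1; [exact: normal_subgroup1 | rewrite mulg1].
by apply: normal_subgroupM => //; exact: NH.
Qed.

Lemma conj_class_refl N C : quotient N setT C -> conj_class N C C.
Proof. by move=> [x _ <-]; exists x, 1; rewrite mul1g invg1 mulg1. Qed.

Lemma quotient_conj_class N H C D :
    normal_subgroup N -> normal_subgroup H -> N `<=` H ->
  conj_class N C D -> quotient N H D <-> quotient N H C.
Proof.
move=> nN nH NH [y [a [-> ->]]].
by rewrite !quotient_lcoset//; exact: normal_subgroupJ.
Qed.

Lemma quotientS N H : quotient N H `<=` quotient N setT.
Proof. exact: image_subset. Qed.

End NormalSubgroup.

Theorem lemma2p11 (G : groupType) (N H : set G)
    (hN : normal_subgroup N) (hH : normal_subgroup H) (hNH : N `<=` H) :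
  lower_apr N (quotient N H) = quotient N H /\
  quotient N H = upper_apr N (quotient N H).
Proof.
have sat C D := @quotient_conj_class G N H C D hN hH hNH.
split; apply/seteqP; split=> C.
- by move=> [/conj_class_refl CC]; apply.
- by move=> HC; split=> [|D /sat ->//]; exact: quotientS HC.
- move=> HC; have TC := quotientS _ _ _ _ HC.
  by split=> //; exists C; split=> //; exact: conj_class_refl.
- by move=> [_ [D [/sat CD HD]]]; exact/CD.
Qed.
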